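(* Let $\mathcal{H}$ be a separable Hilbert space, $K\in B(\mathcal{H})$, let $F=\{f_i\}_{i\in I}$ be a $K$-frame for $\mathcal{H}$ and let $\{g_i\}_{i\in I}$ be a $K$-dual of $F$. Then for every $J\subseteq I$ and every $f\in\mathcal{H}$, $$\left(\sum_{i\in J}\langle f,g_i\rangle\,\overline{\langle Kf,f_i\rangle}\right)-\left\Vert\sum_{i\in J}\langle f,g_i\rangle f_i\right\Vert^2=\left(\sum_{i\in J^c}\overline{\langle f,g_i\rangle}\,\langle Kf,f_i\rangle\right)-\left\Vert\sum_{i\in J^c}\langle f,g_i\rangle f_i\right\Vert^2 .$$
   Context: $B(\mathcal{H})$ is the set of bounded linear operators on $\mathcal{H}$, $I$ is a countable index set, $J^c=I\setminus J$, and the inner product is linear in the first variable. A sequence $\{f_i\}_{i\in I}\subseteq\mathcal{H}$ is a $K$-frame for $\mathcal{H}$ if there exist constants $A,B>0$ such that $A\Vert K^*f\Vert^2\le\sum_{i\in I}|\langle f,f_i\rangle|^2\le B\Vert f\Vert^2$ for all $f\in\mathcal{H}$. A sequence $\{g_i\}_{i\in I}\subseteq\mathcal{H}$ is Bessel if there is $B'>0$ with $\sum_{i\in I}|\langle f,g_i\rangle|^2\le B'\Vert f\Vert^2$ for all $f\in\mathcal{H}$. A Bessel sequence $\{g_i\}_{i\in I}$ is a $K$-dual of $\{f_i\}_{i\in I}$ if $Kf=\sum_{i\in I}\langle f,g_i\rangle f_i$ for all $f\in\mathcal{H}$. *)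

(* Defs.v *)
From HB Require Import structures.
From mathcomp Require Import all_boot all_order all_algebra finmap.
From mathcomp Require Import sesquilinear complex.
From mathcomp Require Import all_classical all_reals all_analysis.
From mathcomp Require Import summability.

Set Implicit Arguments.
Unset Strict Implicit.
Unset Printing Implicit Defensive.

Import Order.TTheory GRing.Theory Num.Theory.
Import numFieldNormedType.Exports.

Local Open Scope classical_set_scope.
Local Open Scope ring_scope.

(* Unconditional sums over an arbitrary subset J of the index type: limits of
   the partial sums along the directed set of finite subsets of I. *)
Section Sums.
Context {C : numFieldType} {V : normedModType C} {I : choiceType}.
Implicit Types (J : set I) (x : I -> V).

Definition partial_sum_on J x : {fset I} -> V :=
  partial_sum (fun i => if i \in J then x i else 0).

Definition has_sum J x (s : V) := partial_sum_on J x @ totally --> s.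

Definition summable_on J x := exists s : V, has_sum J x s.

Definition sum_on J x : V := lim (partial_sum_on J x @ totally).

End Sums.

(* The norm of a space over R[i] takes its values in R[i]; this is the same
   norm as an element of R. *)
Definition rnorm {R : realType} {V : normedZmodType R[i]} (x : V) : R :=
  complex.Re `|x|.

Definition separable (T : topologicalType) :=
  exists D : set T, countable D /\ dense D.

Section Frames.
Context {R : realType} {H : completeNormedModType R[i]}.
(* [{dot H for conj}] is linear in its first argument and conjugate-linear in
   the second. *)
Variable dot : {dot H for @Num.conj R[i]}.
Implicit Types (K : H -> H).

(* H is a Hilbert space for [dot]: its (complete) norm is the one induced by
   [dot]. *)
Definition hilbert_norm := forall x : H, dot x x = `|x| ^+ 2.

Definition bounded_operator K :=
  exists M : R, forall x : H, rnorm (K x) <= M * rnorm x.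

Definition is_adjoint K (Kstar : H -> H) :=
  forall x y : H, dot (K x) y = dot x (Kstar y).

Context {I : countType}.
Implicit Types (F G : I -> H).

(* sum over I of |<f, F_i>|^2, possibly +oo *)
Definition sqsum F (f : H) : \bar R :=
  \esum_(i in [set: I]) ((rnorm (dot f (F i) : R[i])) ^+ 2)%:E.

Definition bessel G := exists B : R, 0 < B /\
  forall f : H, (sqsum G f <= (B * rnorm f ^+ 2)%:E)%E.

(* On a Hilbert space a bounded K has exactly one adjoint, so quantifying
   existentially over Kstar just names it. *)
Definition K_frame K F := exists Kstar : H -> H, is_adjoint K Kstar /\
  exists A B : R, [/\ 0 < A, 0 < B &
    forall f : H, ((A * rnorm (Kstar f) ^+ 2)%:E <= sqsum F f
                   /\ sqsum F f <= (B * rnorm f ^+ 2)%:E)%E].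

Definition K_dual K F G := bessel G /\
  forall f : H, has_sum [set: I] (fun i => dot f (G i) *: F i) (K f).

End Frames.

(* Main.v *)
Require Import Defs.
From HB Require Import structures.
From mathcomp Require Import all_boot all_order all_algebra finmap.
From mathcomp Require Import sesquilinear complex.
From mathcomp Require Import all_classical all_reals all_analysis.
From mathcomp Require Import summability.
From mathcomp Require Import ring.

Set Implicit Arguments.
Unset Strict Implicit.
Unset Printing Implicit Defensive.

Import Order.TTheory GRing.Theory Num.Theory.
Import numFieldNormedType.Exports.

Local Open Scope classical_set_scope.
Local Open Scope ring_scope.


(** Put [S] and [T] for the sums of the vectors [<f, g_i> f_i] over [J] and over
its complement.  Both exist: in a complete space, unconditional convergence
over the whole index set passes to every subset ([summable_onS]).  As the
[g_i] form a K-dual, [S + T = K f] ([has_sum_setC]).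

The two scalar families of the theorem are [<v_i, K f>] and [<K f, v_i>], with
[v_i = <f, g_i> f_i].  The inner product is bounded in each argument by
Cauchy-Schwarz, so it commutes with unconditional sums ([has_sum_dotl],
[has_sum_dotr]), and the scalar sums are [<S, K f>] over [J] and [<K f, T>]
over the complement.  Hence the left-hand side is [<S, S + T> - <S, S>] and the
right-hand side is [<S + T, T> - <T, T>]; both equal [<S, T>]. *)

#[local] Existing Instance totally_filter.

Section UnconditionalSums.
Context {C : numFieldType} {I : choiceType}.

Lemma partial_sum_onE (V : normedModType C) (J : set I) (x : I -> V)
    (A : {fset I}) : partial_sum_on J x A = \sum_(i <- A | i \in J) x i.
Proof.
rewrite /partial_sum_on /partial_sum [RHS]big_mkcond.
by rewrite (big_seq_fsetE _ A xpredT (fun i => if i \in J then x i else 0)).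
Qed.

(** Brings the partial sums over different finite sets under one index set, so
that linear relations between them can be checked term by term. *)
Lemma partial_sum_on_widen (V : normedModType C) (J : set I) (x : I -> V)
    (A B : {fset I}) : (A `<=` B)%fset ->
  partial_sum_on J x A = \sum_(i <- B | (i \in A) && (i \in J)) x i.
Proof.
move=> AB; rewrite partial_sum_onE big_mkcond [RHS]big_mkcond /=.
rewrite -(big_fset_incl _ AB) => [|i _ /negPf->//].
by apply: eq_big_seq => i ->.
Qed.


Lemma sum_onE (V : normedModType C) (J : set I) (x : I -> V) (s : V) :
  has_sum J x s -> sum_on J x = s.
Proof. exact: norm_cvg_lim. Qed.

Lemma has_sumP (V : normedModType C) (J : set I) (x : I -> V) (s : V) :
  has_sum J x s <-> forall e : C, 0 < e -> exists A0 : {fset I},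
    forall A, (A0 `<=` A)%fset -> `|s - partial_sum_on J x A| < e.
Proof.
split=> [/cvgrPdist_lt xs e /xs[A0 _ A0s]|xs].
  by exists A0.
by apply/cvgrPdist_lt => e /xs[A0 A0s]; exists A0.
Qed.

Lemma has_sum_setC (V : normedModType C) (J : set I) (x : I -> V) (s t : V) :
  has_sum J x s -> has_sum (~` J) x t -> has_sum [set: I] x (s + t).
Proof.
move=> xs xt.
rewrite /has_sum.
have -> : partial_sum_on [set: I] x
    = (fun A => partial_sum_on J x A + partial_sum_on (~` J) x A).
  apply/funext => A; rewrite !partial_sum_onE (bigID (fun i => i \in J)) /=.
  by congr (_ + _); apply: eq_bigl => i; rewrite in_setT ?in_setC.
exact: cvgD.
Qed.

(** Additivity, rather than linearity, is required of [f] so that the lemma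
covers both arguments of a sesquilinear form. *)
Lemma has_sum_bounded_additive (V W : normedModType C) (J : set I)
    (x : I -> V) (s : V) (f : {additive V -> W}) (M : C) :
  0 <= M -> (forall u, `|f u| <= M * `|u|) ->
  has_sum J x s -> has_sum J (f \o x) (f s).
Proof.
move=> M0 fM /has_sumP xs; apply/has_sumP => e e0.
(* dividing by [M + 1] instead of [M] allows for [M = 0] *)
have M1 : 0 < M + 1 by rewrite ltr_wpDl.
have [A0 A0s] := xs _ (divr_gt0 e0 M1).
exists A0 => A /A0s; rewrite ltr_pdivlMr// => sA.
have -> : partial_sum_on J (f \o x) A = f (partial_sum_on J x A).
  by rewrite !partial_sum_onE raddf_sum.
rewrite -raddfB (le_lt_trans (fM _))// (le_lt_trans _ sA)// mulrC.
by rewrite ler_wpM2l// lerDl.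
Qed.


(** By completeness it is enough that the partial sums over [J'] are Cauchy.
Enlarging a finite set [A0] to [A] changes the partial sum over [J'] by the
terms with index in [J'] that lie in [A] but not in [A0].  Adding just those
indices to [A0] changes the partial sum over [J] by the same amount, which is
small once [A0] is large. *)
Lemma summable_onS (V : completeNormedModType C) (J' J : set I) (x : I -> V) :
  J' `<=` J -> summable_on J x -> summable_on J' x.
Proof.
move=> J'J [s /has_sumP xs].
suff /cauchy_cvg/cvg_ex[t xt] : cauchy (partial_sum_on J' x @ totally).
  by exists t.
apply: cauchy_exP => e e0.
have e2 : 0 < e / 2 by rewrite divr_gt0.
have [A0 A0s] := xs _ e2.
exists (partial_sum_on J' x A0), A0 => // A /= A0A.
rewrite -ball_normE /=.
pose B := (A0 `|` [fset i in A | i \in J'])%fset.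
have A0B : (A0 `<=` B)%fset by exact: fsubsetUl.
have BA : (B `<=` A)%fset.
  by rewrite fsubUset A0A; apply/fsubsetP => i; rewrite !inE => /andP[].
have -> : partial_sum_on J' x A0 - partial_sum_on J' x A
    = (s - partial_sum_on J x B) - (s - partial_sum_on J x A0).
  rewrite opprB [RHS]addrC addrA subrK.
  apply/eqP; rewrite subr_eq addrAC eq_sym subr_eq; apply/eqP.
  rewrite !(partial_sum_on_widen _ _ A0A) (partial_sum_on_widen _ _ BA).
  rewrite (partial_sum_on_widen _ _ (fsubset_refl A)).
  rewrite !(big_mkcond (fun i => _ && _)) -!big_split /=.
  apply: eq_big_seq => i iA.
  have J'Ji : i \in J' -> i \in J by move=> /set_mem/J'J/mem_set.
  have iAJ' : (i \in [fset k in A | k \in J']%fset) = (i \in J').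
    by rewrite in_fset unfold_in /= iA.
  rewrite /B in_fsetU iA iAJ' /=.
  case: (i \in A0); case: (i \in J') J'Ji => [/(_ isT)->|_] //=;
    case: (i \in J) => //=; rewrite ?addr0 ?add0r// addrC.
by rewrite (le_lt_trans (ler_normB _ _))// [ltRHS]splitr ltrD// A0s//=.
Qed.

End UnconditionalSums.

(** In a space of any dimension this follows from the nonnegativity of the square norm of
[<y, y> x - <x, y> y], which is [<y, y>] times the difference of the two
sides. *)
Lemma cauchy_schwarz (C : numClosedFieldType) (U : lmodType C)
    (dot : {dot U for @Num.conj C}) (x y : U) :
  `|dot x y| ^+ 2 <= dot x x * dot y y.
Proof.
have [->|y0] := eqVneq y 0.
  by rewrite linear0r normr0 expr0n mulr_ge0// dnorm_ge0.
have yy : 0 < dot y y by rewrite dnorm_gt0.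
have := dnorm_ge0 dot (dot y y *: x - dot x y *: y).
rewrite dnormB !dnormZ !linearZl_LR !linearZr_LR /= /GRing.scale /=.
rewrite !rmorphM /= conjCK (CrealP (gtr0_real yy)) gtr0_norm//.
rewrite (mulrA `|dot x y|) -expr2 normCK.
have -> : dot y y * (dot y y * dot x x) + dot x y * (dot x y)^* * dot y y
   - ((dot x y)^* * (dot y y * dot x y) + dot x y * (dot y y * (dot x y)^*))
   = dot y y * (dot x x * dot y y - dot x y * (dot x y)^*) by ring.
by rewrite pmulr_rge0// subr_ge0.
Qed.

Section HilbertSums.
Context {R : realType} {H : completeNormedModType R[i]} {I : choiceType}.
Variable dot : {dot H for @Num.conj R[i]}.
Hypothesis dot_norm : hilbert_norm dot.

Lemma dot_le_norm (x y : H) : `|dot x y| <= `|x| * `|y|.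
Proof.
rewrite -(@ler_pXn2r _ 2)// ?nnegrE ?mulr_ge0// exprMn -!dot_norm.
exact: cauchy_schwarz.
Qed.

Lemma has_sum_dotl (J : set I) (x : I -> H) (s y : H) :
  has_sum J x s -> has_sum J (fun i => dot (x i) y : R[i]^o) (dot s y).
Proof.
apply: (@has_sum_bounded_additive _ _ _ R[i]^o _ _ _ (applyr dot y) `|y|) => //.
by move=> u; rewrite mulrC; exact: dot_le_norm.
Qed.

Lemma has_sum_dotr (J : set I) (x : I -> H) (s y : H) :
  has_sum J x s -> has_sum J (fun i => dot y (x i) : R[i]^o) (dot y s).
Proof.
apply: (@has_sum_bounded_additive _ _ _ R[i]^o _ _ _ (dot y) `|y|) => //.
by move=> u; exact: dot_le_norm.
Qed.

End HilbertSums.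

Theorem theorem2p1 (R : realType) (H : completeNormedModType R[i])
  (dot : {dot H for @Num.conj R[i]}) (dot_norm : hilbert_norm dot)
  (sepH : separable H)
  (K : {linear H -> H}) (Kbounded : bounded_operator K)
  (I : countType) (F G : I -> H)
  (F_frame : K_frame dot K F) (G_dual : K_dual dot K F G)
  (J : set I) (f : H) :
  let a : I -> R[i]^o := fun i => dot f (G i) * (dot (K f) (F i))^* in
  let b : I -> R[i]^o := fun i => (dot f (G i))^* * dot (K f) (F i) in
  let v : I -> H := fun i => dot f (G i) *: F i in
  [/\ summable_on J a, summable_on J v,
      summable_on (~` J) b, summable_on (~` J) v &
      sum_on J a - `|sum_on J v| ^+ 2
      = sum_on (~` J) b - `|sum_on (~` J) v| ^+ 2].
Proof.
move=> a b v.
have [_ /(_ f) vKf] := G_dual.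
have vsub J' : summable_on J' v.
  by apply: (summable_onS (J := setT)); last exists (K f).
have [[s sJ] [t tJ]] := (vsub J, vsub (~` J)).
have Kfst : K f = s + t.
  by rewrite -(sum_onE vKf) (sum_onE (has_sum_setC sJ tJ)).
have aE : a = (fun i => dot (v i) (K f)).
  by apply/funext => i; rewrite /a /v linearZl_LR /= [dot (F i) _]hermC mul1r.
have bE : b = (fun i => dot (K f) (v i)).
  by apply/funext => i; rewrite /b /v linearZr_LR.
have aJ := has_sum_dotl dot_norm (y := K f) sJ.
have bJ := has_sum_dotr dot_norm (y := K f) tJ.
split; [by rewrite aE; eexists; exact: aJ|by exists s
       |by rewrite bE; eexists; exact: bJ|by exists t|].
rewrite aE bE (sum_onE aJ) (sum_onE bJ) (sum_onE sJ) (sum_onE tJ).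
(* what remains is <s, s + t> - <s, s> = <s + t, t> - <t, t> *)
rewrite Kfst -!dot_norm linearDr linearDl /=.
by rewrite addrAC subrr add0r addrK.
Qed.
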